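(* Let $X$ be a dyadic compactum. Then $\pi Nt(X)=\chi_K Nt(X)=\omega$. Moreover, if $X$ is homogeneous, then $Nt(X)=\omega$.
   Context: A compactum is a compact Hausdorff space; a dyadic compactum is a Hausdorff continuous image of $2^\kappa$ for some cardinal $\kappa$. Families of subsets of a space are ordered by inclusion. For a cardinal $\kappa$, a poset is $\kappa^{\mathrm{op}}$-like if no element is below $\kappa$-many elements (i.e. for each $p$, the set $\{q: q\geq p\}$ has size $<\kappa$). The Noetherian type $Nt(X)$ is the least $\kappa\geq\omega$ such that $X$ has a $\kappa^{\mathrm{op}}$-like base; the Noetherian $\pi$-type $\pi Nt(X)$ is the least $\kappa\geq\omega$ such that $X$ has a $\kappa^{\mathrm{op}}$-like $\pi$-base. For $E\subseteq X$, the local Noetherian type $\chi Nt(E,X)$ is the least $\kappa\geq\omega$ such that $E$ has a $\kappa^{\mathrm{op}}$-like neighborhood base (a family of open sets containing $E$ such that every open set containing $E$ contains a member). The compact Noetherian type $\chi_K Nt(X)$ is the supremum of $\chi Nt(K,X)$ over all compact $K\subseteq X$. *)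

(* Defs.v *)
From HB Require Import structures.
From mathcomp Require Import all_boot all_order all_algebra.
From mathcomp Require Import all_classical all_reals topology.
Set Implicit Arguments. Unset Strict Implicit. Unset Printing Implicit Defensive.
Local Open Scope classical_set_scope.

Definition omega_op_like (T : Type) (F : set (set T)) : Prop :=
  forall p, F p -> finite_set [set q | F q /\ p `<=` q].

Definition is_base (X : topologicalType) (B : set (set X)) : Prop :=
  (forall b, B b -> open b) /\
  (forall U x, open U -> U x -> exists b, [/\ B b, b x & b `<=` U]).

Definition is_pi_base (X : topologicalType) (B : set (set X)) : Prop :=
  (forall b, B b -> open b /\ b !=set0) /\
  (forall U, open U -> U !=set0 -> exists b, B b /\ b `<=` U).

Definition is_nbhd_base (X : topologicalType) (E : set X) (B : set (set X)) : Prop :=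
  (forall b, B b -> open b /\ E `<=` b) /\
  (forall U, open U -> E `<=` U -> exists b, B b /\ b `<=` U).

Definition Nt_omega (X : topologicalType) : Prop :=
  exists B : set (set X), is_base B /\ omega_op_like B.

Definition piNt_omega (X : topologicalType) : Prop :=
  exists B : set (set X), is_pi_base B /\ omega_op_like B.

Definition chiNt_omega (X : topologicalType) (E : set X) : Prop :=
  exists B : set (set X), is_nbhd_base E B /\ omega_op_like B.

(* chi_K Nt(X) = omega : the supremum over compact K of chiNt(K,X) is omega,
   i.e. every compact K has chiNt(K,X) = omega *)
Definition chiKNt_omega (X : topologicalType) : Prop :=
  forall K : set X, compact K -> chiNt_omega K.

Definition dyadic_compactum (X : topologicalType) : Prop :=
  hausdorff_space X /\
  exists (I : Type) (f : prod_topology (fun _ : I => bool) -> X),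
    continuous f /\ (forall x : X, exists t, f t = x).

Definition homogeneous (X : topologicalType) : Prop :=
  forall x y : X, exists h : X -> X, exists g : X -> X,
    [/\ continuous h, continuous g, cancel h g, cancel g h & h x = y].

(* Main.v *)
Require Import Defs.
From mathcomp Require Import all_boot.
From mathcomp Require Import all_classical all_reals topology.
From mathcomp Require wochoice.

(** Let [f] map the cube [2^I] onto [X]. Each of the three families is built by
    transfinite recursion: a list of requirements (refine the next member of a
    base of minimal size) is treated one at a time, and at stage [a] only finitely
    many clopen sets [C] of the cube are chosen, none containing a "large" clopen
    set supported by the set [J] of coordinates used before. A large clopen set [E]
    contained in a set [C] chosen at stage [a] must then have in its finite support a
    coordinate that is new at stage [a], as otherwise the projection of [E] to [J]
    would be large and contained in [C]. So [E] lies in only finitely many chosen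
    sets, and the open sets [inner C], the points whose whole fibre lies in [C],
    form an [omega^op]-like family.

    Such [C] exist at every stage because [J] is small compared to the minimal size.
    For bases this requires that no point has a local pi-base smaller than the
    weight, which holds if [X] is homogeneous: closing a set [J] of coordinates that
    supports local pi-bases at enough points gives a closed set of the cube which
    [f] maps onto [X] and on which [f] only depends on the coordinates in [J]. *)

Set Implicit Arguments.
Unset Strict Implicit.
Unset Printing Implicit Defensive.

Local Open Scope classical_set_scope.

(** * Sets enumerated by words *)

Section Generation.
Variable I : eqType.
Implicit Types J : set I.

Definition words J : set (seq I * nat) := [set c | forall i, i \in c.1 -> J i].

(* [S] is enumerated by the words over [J]; in particular [S] has cardinality at
   most that of the set of finite subsets of [J], or is countable. *)
Definition gen J (T : Type) (S : set T) :=
  exists h : seq I * nat -> option T,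
    forall t, S t -> exists2 c, words J c & h c = Some t.

Lemma gen_words J : gen J (words J).
Proof. by exists Some => c Jc; exists c. Qed.

Lemma gen_sub J T (S S' : set T) : S' `<=` S -> gen J S -> gen J S'.
Proof. by move=> S'S [h hP]; exists h => t /S'S /hP. Qed.

Lemma gen_map J T T' (F : T -> option T') (S : set T) :
  gen J S -> gen J [set t' | exists2 t, S t & F t = Some t'].
Proof.
move=> [h hP]; exists (obind F \o h) => t' [t /hP[c Jc hc] Ft].
by exists c => //=; rewrite hc.
Qed.

Lemma gen_count J (T : countType) : gen J [set: T].
Proof.
exists (fun c => unpickle c.2) => t _; exists ([::], pickle t) => //=.
by rewrite pickleK.
Qed.

Lemma gen_pair J T T' (S : set T) (S' : set T') :
  gen J S -> gen J S' -> gen J (S `*` S').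
Proof.
move=> [h hP] [h' hP'].
(* The word of a pair concatenates the two words; its number also records the length [k] at which to
   cut. *)
exists (fun c => if unpickle c.2 is Some (k, n, n') then
  if (h (take k c.1, n), h' (drop k c.1, n')) is (Some t, Some t')
  then Some (t, t') else None else None).
move=> [t t'] [/= /hP[[l n] Jl hl] /hP'[[l' n'] Jl' hl']].
exists (l ++ l', pickle (size l, n, n')).
  by move=> i /=; rewrite mem_cat => /orP[/Jl|/Jl'].
by rewrite /= pickleK take_size_cat // drop_size_cat // hl hl'.
Qed.

Lemma gen_bigcup J T (S : nat -> set T) :
  (forall n, gen J (S n)) -> gen J (\bigcup_n S n).
Proof.
move=> /choice[h hP].
exists (fun c => if unpickle c.2 is Some (k, n) then h k (c.1, n) else None).
move=> t [k _ /hP[[l n] Jl hl]]; exists (l, pickle (k, n)) => //=.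
by rewrite pickleK.
Qed.

Lemma gen_self J : gen J J.
Proof.
exists (ohead \o fst) => i Ji; exists ([:: i], 0) => // j.
by rewrite inE => /eqP ->.
Qed.

Lemma gen_setU J T (S S' : set T) : gen J S -> gen J S' -> gen J (S `|` S').
Proof.
move=> gS gS'; apply: (@gen_sub _ _ (\bigcup_n (if n is 0 then S else S'))).
  by move=> t [St|S't]; [exists 0|exists 1].
by apply: gen_bigcup => -[|n].
Qed.

Lemma gen_set1 J T (t : T) : gen J [set t].
Proof. by exists (fun=> Some t) => _ ->; exists ([::], 0). Qed.

Lemma gen_seq J (T : eqType) (S : set T) :
  gen J S -> gen J [set l : seq T | forall t, t \in l -> S t].
Proof.
move=> gS; pose L n := [set l : seq T | (forall t, t \in l -> S t) /\ size l = n].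
apply: (@gen_sub _ _ (\bigcup_n L n)) => [l Sl|]; first by exists (size l).
apply: gen_bigcup; elim=> [|n IH].
  by apply: gen_sub (gen_set1 J [::]) => l [_ /size0nil].
apply: gen_sub (gen_map (fun c => Some (c.1 :: c.2)) (gen_pair gS IH)).
move=> [|t l] [Sl //= [sl]]; exists (t, l) => //; split => /=.
  by apply: Sl; rewrite mem_head.
by split=> // u ul; apply: Sl; rewrite inE ul orbT.
Qed.

Lemma gen_bigcup_seq J T (K : eqType) (S : set T) (s : T -> seq K) :
  gen J S -> gen J [set i | exists2 t, S t & i \in s t].
Proof.
move=> gS; apply: gen_sub (gen_map
  (fun c => onth (s c.1) c.2) (gen_pair gS (gen_count J nat))).
move=> i [t St its]; exists (t, index i (s t)) => //=.
by rewrite onthE (nth_map i) ?index_mem // nth_index.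
Qed.

End Generation.

(** A word over [K] is a finite sequence in [K] with a number, so it is itself coded by a word over
    [J]. *)
Lemma gen_trans (I I' : eqType) (J : set I) (K : set I') T (S : set T) :
  gen J K -> gen K S -> gen J S.
Proof.
move=> gK [h hP].
apply: gen_sub (gen_map h (gen_pair (gen_seq gK) (gen_count J nat))) => t /hP.
by move=> [[l n] Kl hl]; exists (l, n).
Qed.

(** Countably many rounds of closing suffice: a word has finitely many letters, so it appears at a
    finite round. *)
Lemma gen_closure (I : eqType) (J : set I)
    (phi : seq I * nat -> seq I * nat -> seq I) :
  exists2 J', gen J J' & forall c d i,
    words J' c -> words J d -> i \in phi c d -> J' i.
Proof.
pose next K := K `|` [set i | exists2 p,
  (words K `*` words J) p & i \in phi p.1 p.2].
pose Jn n := iter n next J.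
have Jmono m n : (m <= n)%N -> Jn m `<=` Jn n.
  move=> /subnK <-; elim: (n - m)%N => // k IH i /IH ?.
  by left.
exists (\bigcup_n Jn n).
- apply: gen_bigcup; elim=> [|n IH]; first exact: gen_self.
  apply: gen_setU => //.
  apply: (gen_bigcup_seq (fun p => phi p.1 p.2)); apply: gen_pair (gen_words J).
  exact: gen_trans IH (gen_words _).
- move=> c d i Jc Jd ic.
  have [n Jnc] : exists n, words (Jn n) c.
    case: c Jc {ic} => l k; rewrite /words /=; elim: l => [|j l IH] Jl.
      by exists 0.
    have [|n nl] := IH; first by move=> x xl; apply: Jl; rewrite inE xl orbT.
    have [m _ mj] := Jl j (mem_head _ _).
    exists (maxn m n) => x; rewrite inE => /orP[/eqP ->|/nl].
      exact: Jmono (leq_maxl _ _) _ mj.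
    exact: Jmono (leq_maxr _ _) _.
  by exists n.+1 => //; right; exists (c, d).
Qed.

(** * Well-orders and the stages of the recursion *)

Lemma wf_min T (lt : T -> T -> Prop) (S : set T) : well_founded lt ->
  S !=set0 -> exists2 m, S m & forall x, lt x m -> ~ S x.
Proof.
move=> wf [x0 Sx0]; apply: contrapT => noM; move: Sx0.
elim/(well_founded_ind wf): x0 => x IH Sx; apply: noM.
by exists x => // y /IH.
Qed.

Lemma exists_well_order (T : Type) : exists lt : T -> T -> Prop,
  [/\ well_founded lt, forall x y, [\/ x = y, lt x y | lt y x]
    & forall y x z, lt x y -> lt y z -> lt x z].
Proof.
have [R woR] := @wochoice.well_ordering_principle {classic T}.
have woC : wochoice.wo_chain R predT by move=> A _; exact: woR.
have anti (x y : {classic T}) : R x y -> R y x -> x = y.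
  move=> xy yx; apply: (wochoice.wo_chain_antisymmetric woC) => //.
  by rewrite xy yx.
have tot (x y : {classic T}) : R x y || R y x.
  by apply: (wochoice.wo_chainW woC).
pose lt (x y : {classic T}) : Prop := R x y /\ x <> y.
have wf : well_founded lt.
  move=> x; apply: contrapT => nx.
  have [|z [[zA zmin] _]] := woR [pred x | `[< ~ Acc lt x >]].
    by exists x; rewrite unfold_in; apply/asboolP.
  move: zA; rewrite unfold_in => /asboolP; apply; apply: Acc_intro => y [yz neq].
  apply: contrapT => ny; apply: neq; apply: anti => //.
  by apply: zmin; rewrite unfold_in; apply/asboolP.
have tri x y : [\/ x = y, lt x y | lt y x].
  have [->|/eqP neq] := eqVneq x y; first by constructor 1.
  have /orP[xy|yx] := tot x y; first by constructor 2.
  by constructor 3; split=> // /esym.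
exists lt; split => // y x z xy yz; have [E|//|zx] := tri x z.
  case: yz => yz nyz; case: xy => xy _.
  by exfalso; apply: nyz; apply: anti => //; rewrite -E.
(* A cycle [x], [y], [z] would have no minimal element. *)
have [|m mE mmin] := @wf_min _ lt [set t | [\/ t = x, t = y | t = z]] wf.
  by exists x; constructor 1.
exfalso; case: mE mmin => -> mmin.
- by apply: (mmin _ zx); constructor 3.
- by apply: (mmin _ xy); constructor 1.
- by apply: (mmin _ yz); constructor 2.
Qed.

(* Either countably many stages suffice, or the stages are the words over a
   minimal initial segment of a well-order, sorted by their greatest letter: the
   words preceding a given one then only use letters from a proper initial
   segment plus one letter, so no cardinal arithmetic is needed. *)
Lemma exists_stages (I : eqType) (T : Type) (P : set T -> Prop) :
  P setT -> (forall S S', S `<=` S' -> P S -> P S') ->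
  exists (N : Type) (lt : N -> N -> Prop) (e : N -> option T),
  [/\ well_founded lt, forall a b, [\/ a = b, lt a b | lt b a],
      P [set t | exists a, e a = Some t]
    & forall a (s : N -> seq I), e a ->
      let J := [set i | exists2 b, lt b a & i \in s b] in
      (exists l : seq I, forall i, J i -> i \in l) \/ (forall S, gen J S -> ~ P S)].
Proof.
move=> PT Pmono.
(* Words over the empty set are just numbers: here the stages are the natural numbers, and finitely
   many coordinates occur before each. *)
have [[S [gS PS]]|ncount] :=
  pselect (exists S, gen (set0 : set {classic T}) S /\ P S).
  have [h hP] := gS.
  exists nat, (fun m n => (m < n)%N), (fun n => h ([::], n)); split.
  - by elim/ltn_ind => n IH; apply: Acc_intro => m; exact: IH.
  - by move=> m n; case: (ltngtP m n) => H; constructor.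
  - apply: Pmono PS => t /hP[[[|x l] n] Jl ht]; first by exists n.
    by have := Jl x (mem_head _ _).
  - move=> a s _; left; exists (flatten [seq s b | b <- iota 0 a]) => i [b ba ib].
    by apply/flattenP; exists (s b) => //; apply: map_f; rewrite mem_iota.
have [lt [wf tri trans]] := exists_well_order {classic T}.
pose seg a : set {classic T} := [set x | lt x a].
pose good (A : set {classic T}) := exists S : set T, gen A S /\ P S.
(* [A] is the least good segment, or the whole type if no segment is good. *)
have [A [gA downA Amin]] : exists A, [/\ good A,
    forall x y, A y -> lt x y -> A x & forall a, A a -> ~ good (seg a)].
  have [[a0 ga0]|nseg] := pselect (exists a, good (seg a)).
    have [|a ga amin] := @wf_min _ lt [set a | good (seg a)] wf.
      by exists a0.
    by exists (seg a); split=> // x y ya /trans; apply.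
  exists setT; split=> // [|a _ ga]; last by apply: nseg; exists a.
  exists setT; split=> //; exists (fun c => ohead c.1) => t _.
  by exists ([:: t], 0).
have [a0 Aa0] : A !=set0.
  apply/set0P/eqP => A0; apply: ncount; case: gA => S gS.
  by exists S; rewrite -A0.
have [S [[h hP] PS]] := gA.
have irr x : ~ lt x x.
  by elim/(well_founded_ind wf): x => x IH xx; exact: (IH x).
pose mx (x y : {classic T}) := if `[< lt x y >] then y else x.
pose le x y := x = y \/ lt x y.
have letrans y x z : le x y -> le y z -> le x z.
  move=> [->//|xy] [<-|yz]; right=> //; exact: trans yz.
have mxl x y : le x (mx x y).
  by rewrite /mx; case: asboolP => xy; [right|left].
have mxr x y : le y (mx x y).
  rewrite /mx; case: asboolP => xy; first by left.
  by case: (tri x y) => [->|//|]; [left|right].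
pose rk := foldr mx a0.
have rkle l x : x \in l -> le x (rk l).
  elim: l => //= y l IH; rewrite inE => /orP[/eqP ->|/IH xl]; first exact: mxl.
  exact: letrans (mxr _ _).
have rkA l : (forall x, x \in l -> A x) -> A (rk l).
  elim: l => //= y l IH lA; rewrite /mx; case: asboolP => _.
    by apply: IH => x xl; apply: lA; rewrite inE xl orbT.
  by apply: lA; rewrite mem_head.
have [ltw [wfw triw _]] := exists_well_order (seq {classic T} * nat).
(* [rk] is the greatest letter, at least [a0]; an arbitrary well-order of the words breaks ties. *)
pose ltn (c d : seq {classic T} * nat) :=
  lt (rk c.1) (rk d.1) \/ rk c.1 = rk d.1 /\ ltw c d.
exists _, ltn, (fun c => if `[< words A c >] then h c else None); split.
- move=> c; move: {2}(rk c.1) (erefl (rk c.1)) => r.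
  elim/(well_founded_ind wf): r c => r IHr c.
  elim/(well_founded_ind wfw): c => c IHc rc.
  apply: Acc_intro => d [dc|[dc dcw]].
    by apply: (IHr (rk d.1)) => //; rewrite -rc.
  by apply: IHc => //; rewrite dc.
- move=> c d; case: (tri (rk c.1) (rk d.1)) => [E|H|H].
  + by case: (triw c d) => [H|H|H]; [constructor 1|constructor 2|constructor 3] => //;
      right.
  + by constructor 2; left.
  + by constructor 3; left.
- apply: Pmono PS => t /hP[c Ac hc]; exists c.
  by case: asboolP.
- move=> c s; case: asboolP => // Ac _ J; right => R gR PR.
  have Ar := rkA _ Ac; apply: (Amin _ Ar); exists R; split=> //.
  (* Adding the single letter [rk c.1] to the segment does not enlarge what it generates. *)
  apply: gen_trans (gen_setU (gen_self _) (gen_set1 (seg (rk c.1)) (rk c.1))) _.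
  apply: gen_trans gR; apply: gen_sub (gen_bigcup_seq s (gen_words _)).
  move=> i [d dc id]; exists d => // x /rkle xd.
  have : le x (rk c.1).
    by case: dc => [dc|[<- _]] //; apply: letrans xd _; right.
  by case; [right|left].
Qed.

(** * Clopen sets of the cube *)

Section Cylinders.
Variable I : eqType.
Local Notation cube := (prod_topology (fun _ : I => bool)).
Implicit Types (J : set I) (l : seq I) (c : seq I * nat) (E C : set cube).

Definition dep l E := forall x y, (forall i, i \in l -> x i = y i) -> E x -> E y.

(* Every set depending on the coordinates in [l] is some [cyl (l, n)], the number
   [n] coding the list of its restrictions to [l]; see [depP]. *)
Definition cyl c : set cube :=
  [set x | map x c.1 \in odflt [::] (unpickle c.2 : option (seq (seq bool)))].

Lemma dep_cyl c : dep c.1 (cyl c).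
Proof.
by move=> x y xy; rewrite /cyl /=; rewrite (_ : map x c.1 = map y c.1) //;
  apply/eq_in_map.
Qed.

Lemma dep_sub l l' E : {subset l <= l'} -> dep l E -> dep l' E.
Proof. by move=> ll' lE x y xy; apply: lE => i /ll'; exact: xy. Qed.

Lemma depC l E : dep l E -> dep l (~` E).
Proof. by move=> lE x y xy nEx Ey; apply: nEx; apply: lE Ey => i /xy. Qed.

Lemma depU l l' E E' : dep l E -> dep l' E' -> dep (l ++ l') (E `|` E').
Proof.
move=> lE lE' x y xy [Ex|Ex']; [left; apply: lE Ex|right; apply: lE' Ex'].
  by move=> i il; apply: xy; rewrite mem_cat il.
by move=> i il; apply: xy; rewrite mem_cat il orbT.
Qed.

Lemma depP l E : dep l E -> exists n, cyl (l, n) = E.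
Proof.
move=> lE; pose L : seq (seq bool) := [seq t <- [seq val t | t : (size l).-tuple bool] |
   `[< exists2 x : cube, E x & map x l = t >]].
exists (pickle L); apply/seteqP; split=> x; rewrite /cyl /mkset pickleK.
  rewrite mem_filter => /andP[/asboolP[y Ey yx] _].
  by apply: lE Ey; apply/eq_in_map.
move=> Ex; rewrite mem_filter; apply/andP; split; first by apply/asboolP; exists x.
by apply/mapP; exists (map_tuple x (in_tuple l)); rewrite ?mem_enum.
Qed.

Lemma finite_dep l : finite_set (dep l).
Proof.
pose F (A : {set (size l).-tuple bool}) : set cube :=
  [set x | map_tuple x (in_tuple l) \in A].
apply: (@sub_finite_set _ _ (F @` setT)); last exact/finite_image/finite_finset.
move=> E lE; exists [set t | `[< exists2 x : cube, E x & map x l = val t >]]%SET => //.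
apply/seteqP; split=> x; rewrite /F /= inE.
  by move=> /asboolP[y Ey yx]; apply: lE Ey; apply/eq_in_map.
by move=> Ex; apply/asboolP; exists x.
Qed.

(** The inverse image of the projection of [E] to the cube over [J]. *)
Definition cproj J E : set cube :=
  [set z | exists2 y, E y & forall i, J i -> y i = z i].

Lemma sub_cproj J E : E `<=` cproj J E.
Proof. by move=> x Ex; exists x. Qed.

Lemma dep_cproj J l E : dep l E -> dep [seq i <- l | `[< J i >]] (cproj J E).
Proof.
move=> lE z z' zz' [y Ey yz].
exists (fun i => if `[< J i >] then z' i else y i); last first.
  by move=> i Ji; case: asboolP.
apply: lE Ey => i il; case: asboolP => // Ji.
by rewrite yz // zz' // mem_filter il andbT; apply/asboolP.
Qed.

End Cylinders.

(* If [E] is contained in a set chosen at stage [a], its support must meet the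
   coordinates appearing for the first time at stage [a]; otherwise projecting [E]
   to the coordinates known by then gives a set forbidden at stage [a]. *)
Lemma exists_selection (I : eqType) (N : Type) (lt : N -> N -> Prop)
    (G : set (set (prod_topology (fun _ : I => bool))))
    (task : N -> seq (seq I * nat) -> Prop) :
  well_founded lt -> (forall a b, [\/ a = b, lt a b | lt b a]) ->
  (forall E E', E `<=` E' -> G E -> G E') ->
  (forall a (s : N -> seq I), exists2 w, task a w & forall c, c \in w ->
     forall l E, (forall i, i \in l -> exists2 b, lt b a & i \in s b) ->
       dep l E -> G E -> ~ E `<=` cyl c) ->
  exists2 w : N -> seq (seq I * nat), forall a, task a (w a) &
    forall l E, dep l E -> G E ->
      finite_set [set c | exists2 a, c \in w a & E `<=` cyl c].
Proof.
move=> wf tri Gup step.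
pose supp (w : seq (seq I * nat)) := flatten (map fst w).
pose prev a (r : forall b, lt b a -> seq (seq I * nat)) b :=
  if pselect (lt b a) is left ba then supp (r b ba) else [::].
have /choice[pick pickP] : forall p : N * (N -> seq I), exists w,
    task p.1 w /\ forall c, c \in w -> forall l E,
      (forall i, i \in l -> exists2 b, lt b p.1 & i \in p.2 b) ->
      dep l E -> G E -> ~ E `<=` cyl c.
  by move=> [a s]; have [w ? ?] := step a s; exists w.
pose w := Fix wf (fun=> seq (seq I * nat)) (fun a r => pick (a, prev a r)).
have wE a : w a = pick (a, prev a (fun b _ => w b)).
  rewrite /w Fix_eq // => b r r' rr'; congr (pick (_, _)).
  by apply/funext => d; rewrite /prev; case: pselect => // db; rewrite rr'.
exists w => [a|l E lE GE].
  by rewrite wE; exact: (pickP (a, prev a (fun b _ => w b))).1.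
pose new i a := i \in supp (w a) /\ ~ exists2 b, lt b a & i \in supp (w b).
have newP a c : c \in w a -> E `<=` cyl c -> exists2 i, i \in l & new i a.
  move=> ca Ec; apply: contrapT => nnew; move: (ca); rewrite wE => ca'.
  (* Projecting [E] to the support of [w a] keeps it inside [cyl c]; if [l] has no new coordinate,
     the projection depends on earlier ones only. *)
  apply: ((pickP (a, prev a (fun b _ => w b))).2 c ca' _ _ _
    (dep_cproj (J := [set i | i \in supp (w a)]) lE)).
  - move=> i; rewrite mem_filter => /andP[/asboolP ia il] /=.
    have [b ba ib] : exists2 b, lt b a & i \in supp (w b).
      by apply: contrapT => nb; apply: nnew; exists i.
    by exists b => //; rewrite /prev; case: pselect.
  - exact: Gup (@sub_cproj _ _ _) GE.
  - move=> z [y /Ec cy yz]; apply: dep_cyl cy => i ic; apply: yz => /=.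
    by apply/flattenP; exists c.1 => //; apply: map_f.
(* Each coordinate is new at no more than one stage, where finitely many sets are chosen. *)
apply: (@sub_finite_set _ _
    (\bigcup_(i in [set` l]) [set c | exists2 a, new i a & c \in w a])).
  by move=> c [a ca Ec]; have [i il ia] := newP a c ca Ec; exists i => //; exists a.
apply: bigcup_finite => // i _.
have [[a ia]|na] := pselect (exists a, new i a).
  apply: (@sub_finite_set _ _ [set` w a]) => // c [b ib cb] /=.
  have [->|ab|ba] := tri a b => //.
    by case: ib => _ []; exists a => //; case: ia.
  by case: ia => _ []; exists b => //; case: ib.
by apply: (@sub_finite_set _ _ set0) => // c [a ia]; case: na; exists a.
Qed.

(** * Compactness *)

(** If [Q K] failed, the sets whose complement in [K] satisfies [Q] would form a proper filter; the
    local hypothesis fails at a cluster point of it. *)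
Lemma compact_local (X : topologicalType) (K : set X) (Q : set X -> Prop) :
  compact K -> Q set0 -> (forall A B, Q A -> Q B -> Q (A `|` B)) ->
  (forall A B, A `<=` B -> Q B -> Q A) ->
  (forall x, K x -> exists2 U, nbhs x U & Q U) -> Q K.
Proof.
move=> cK Q0 QU Qsub loc; apply: contrapT => nQK.
pose F : set_system X := [set A | Q (K `\` A)].
have FF : ProperFilter F.
  split; first by rewrite /F /mkset setD0.
  split; rewrite /F.
  - by rewrite /mkset setDT.
  - by move=> A B QA QB; rewrite /mkset setDIr; exact: QU.
  - by move=> A B AB; apply: Qsub; exact: setDS.
have [|x [Kx clx]] := cK F FF; first by rewrite /F /= setDv.
have [U Ux QU'] := loc x Kx.
have [|y []//] := clx (~` U) U _ Ux.
by rewrite /F /=; apply: Qsub QU' => y [_ /contrapT].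
Qed.

Section Cube.
Variable I : eqType.
Local Notation cube := (prod_topology (fun _ : I => bool)).
Implicit Types (l : seq I) (E : set cube).

Definition box (x : cube) l : set cube := [set y | forall i, i \in l -> y i = x i].

Lemma dep_box x l : dep l (box x l).
Proof. by move=> y z yz yx i il; rewrite -yz // yx. Qed.

Lemma nbhs_box (x : cube) l : nbhs x (box x l).
Proof.
elim: l => [|i l IH]; first by apply: filterS filterT.
have : nbhs x (proj i @^-1` [set x i]).
  by apply: (@proj_continuous I (fun=> bool) i x); rewrite nbhs_principalE.
move=> H; apply: filterS (filterI H IH) => y [/= yi yl] j; rewrite inE.
by case/orP => [/eqP ->|/yl].
Qed.

Lemma nbhs_boxP (x : cube) (U : set cube) : nbhs x U -> exists l, box x l `<=` U.
Proof.
pose F := filter_from [set: seq I] (box x).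
have FF : Filter F.
  apply: filter_from_filter; first by exists [::].
  move=> l l' _ _; exists (l ++ l') => // y yx.
  by split=> i il; apply: yx; rewrite mem_cat il ?orbT.
suff cvg : F --> x by move=> /cvg[l _ lU]; exists l.
apply/cvg_sup => i V [W] [[O] oO <-] Oxi OV.
exists [:: i] => // y yx; apply: OV => /=.
by rewrite yx ?mem_head.
Qed.

Lemma dep_open l E : dep l E -> open E.
Proof.
move=> lE; rewrite openE => x Ex; apply: filterS (nbhs_box x l) => y yx.
by apply: lE Ex => i il; rewrite yx.
Qed.

Lemma dep_closed l E : dep l E -> closed E.
Proof. by move=> /depC /dep_open; rewrite openC. Qed.

Lemma cube_compact : compact [set: cube].
Proof.
have -> : [set: cube] = [set x : cube | forall i, [set: bool] (x i)].
  by apply/seteqP; split.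
exact: (@tychonoff I (fun=> bool) (fun=> setT) (fun=> bool_compact)).
Qed.

Lemma interpolate_cube (A U : set cube) : closed A -> open U -> A `<=` U ->
  exists l C, [/\ dep l C, A `<=` C & C `<=` U].
Proof.
move=> cA oU AU.
apply: (@compact_local _ A
  (fun B => exists l C, [/\ dep l C, B `<=` C & C `<=` U])).
- exact: subclosed_compact cA cube_compact _.
- by exists [::], set0; split => // x y.
- move=> B B' [l [C [lC BC CU]]] [l' [C' [lC' BC' CU']]].
  exists (l ++ l'), (C `|` C'); split; first exact: depU.
    by apply: setUSS.
  by move=> x [/CU|/CU'].
- by move=> B B' BB' [l [C [lC BC CU]]]; exists l, C; split=> // x /BB' /BC.
- move=> x /AU Ux; have [l lU] := nbhs_boxP (open_nbhs_nbhs (conj oU Ux)).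
  exists (box x l); first exact: nbhs_box.
  by exists l, (box x l); split=> //; exact: dep_box.
Qed.

End Cube.

(** * From clopen sets of the cube to open sets of its image *)

Section DyadicImage.
Variables (I : eqType) (X : topologicalType).
Local Notation cube := (prod_topology (fun _ : I => bool)).
Variable f : cube -> X.
Hypothesis hX : hausdorff_space X.
Hypothesis cf : continuous f.
Hypothesis surjf : forall x, exists t, f t = x.
Implicit Types (l : seq I) (C E : set cube) (U V O K : set X).

Definition inner C : set X := [set x | forall t, f t = x -> C t].

Lemma sub_inner C K : (f @^-1` K `<=` C) <-> (K `<=` inner C).
Proof.
split=> [KC x Kx t ft|KC t Kt]; first by apply: KC; rewrite /= ft.
exact: (KC _ Kt).
Qed.

Lemma inner_sub C U : C `<=` f @^-1` U -> inner C `<=` U.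
Proof. by move=> CU x Cx; have [t tx] := surjf x; rewrite -tx; apply/CU/Cx. Qed.

Lemma inner_mono C C' : C `<=` C' -> inner C `<=` inner C'.
Proof. by move=> CC' x Cx t /Cx /CC'. Qed.

Lemma closed_image A : closed A -> closed (f @` A).
Proof.
move=> cA; apply: compact_closed => //; apply: continuous_compact.
  exact: continuous_subspaceT.
exact: subclosed_compact cA (@cube_compact _) _.
Qed.

Lemma innerE C : inner C = ~` (f @` (~` C)).
Proof.
apply/seteqP; split=> [x Cx [t nCt tx]|x nx t tx]; first exact/nCt/Cx.
by apply: contrapT => nCt; apply: nx; exists t.
Qed.

Lemma inner_open l C : dep l C -> open (inner C).
Proof.
by move=> lC; rewrite innerE openC; exact: closed_image (dep_closed (depC lC)).
Qed.

Lemma compactX : compact [set: X].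
Proof.
have -> : [set: X] = f @` setT.
  by apply/seteqP; split=> // x _; have [t tx] := surjf x; exists t.
apply: continuous_compact; first exact: continuous_subspaceT.
exact: cube_compact.
Qed.

Lemma interpolate K U : compact K -> open U -> K `<=` U ->
  exists c, f @^-1` K `<=` cyl c /\ cyl c `<=` f @^-1` U.
Proof.
move=> cK oU KU.
have cK' : closed (f @^-1` K).
  by apply: closed_comp (compact_closed hX cK) => t _; exact: cf.
have oU' : open (f @^-1` U) by move/continuousP: cf; apply.
have [l [C [lC KC CU]]] := interpolate_cube cK' oU' (fun t (Kt : K (f t)) => KU _ Kt).
have [n Cn] := depP lC; exists (l, n); rewrite Cn; split=> //.
Qed.

Lemma interpolate1 x U : open U -> U x ->
  exists c, inner (cyl c) x /\ cyl c `<=` f @^-1` U.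
Proof.
move=> oU Ux; have [_ ->//|c [xc cU]] := interpolate (@compact_set1 _ x) oU.
by exists c; split=> //; move/sub_inner: xc; apply.
Qed.

(** If [inner (cyl c)] lies in [inner (cyl d)], then the large set [E] lies in [cyl d], which leaves
    finitely many [d]. *)
Lemma selection_op_like (G : set (set cube)) N (w : N -> seq (seq I * nat)) :
  (forall l E, dep l E -> G E ->
     finite_set [set c | exists2 a, c \in w a & E `<=` cyl c]) ->
  (forall a c, c \in w a -> exists l E,
     [/\ dep l E, G E & E `<=` f @^-1` inner (cyl c)]) ->
  omega_op_like [set b | exists a c, c \in w a /\ b = inner (cyl c)].
Proof.
move=> wfin wG p [a [c [ca ->]]]; have [l [E [lE GE Ec]]] := wG a c ca.
apply: (@sub_finite_set _ _ ((inner \o @cyl I) @`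
  [set c | exists2 a, c \in w a & E `<=` cyl c])); last first.
  by apply: finite_image; exact: wfin lE GE.
move=> q [[b [d [db ->]]] cd]; exists d => //; exists b => // t /Ec /cd.
exact.
Qed.

(** Remove from the space one point outside [A] of each member of [D]; finite sets are closed. *)
Lemma escape_finite (D : set (set X)) (A : set X) : finite_set D ->
  (forall O, D O -> ~ O `<=` A) ->
  exists U, [/\ open U, A `<=` U & forall O, D O -> ~ O `<=` U].
Proof.
move=> finD DA.
have /choice[z zP] : forall O, exists z, D O -> O z /\ ~ A z.
  move=> O; have [DO|nDO] := pselect (D O).
    by have /existsNP[z /not_implyP zP] := DA O DO; exists z.
  by exists (f (fun=> true)).
exists (~` (z @` D)); split.
- rewrite openC; apply: accessible_finite_set_closed.1 (finite_image _ finD).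
  exact: hausdorff_accessible.
- by move=> x Ax [O DO zx]; have [_] := zP O DO; rewrite zx.
- by move=> O DO /(_ _ (zP O DO).1); apply; exists O.
Qed.

Lemma finite_inner_dep l : finite_set [set inner E | E in dep l].
Proof. exact/finite_image/finite_dep. Qed.

Lemma words_dep (J : set I) l c :
  (forall i, J i -> i \in l) -> words J c -> dep l (cyl c).
Proof. by move=> Jl Jc; apply: dep_sub (@dep_cyl _ c) => i /Jc /Jl. Qed.

(** * Neighbourhood bases of compact sets *)

Lemma dyadic_chiNt K : compact K -> chiNt_omega K.
Proof.
move=> cK; have [oK|noK] := pselect (open K).
  exists [set K]; split.
    by split=> [b ->|U _ KU]; [split|exists K].
  by move=> p _; apply: (@sub_finite_set _ _ [set K]) => // q [].
(* Large means here: containing the whole preimage of [K]. *)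
pose G E := f @^-1` K `<=` E.
pose P (S : set (seq I * nat)) := forall U, open U -> K `<=` U ->
  exists c, [/\ S c, G (cyl c) & cyl c `<=` f @^-1` U].
have PT : P setT.
  by move=> U oU KU; have [c [Kc cU]] := interpolate cK oU KU; exists c.
have Pmono S S' : S `<=` S' -> P S -> P S'.
  by move=> SS' PS U oU KU; have [c [/SS']] := PS U oU KU; exists c.
have [N [lt [e [wf tri Pe small]]]] := exists_stages I PT Pmono.
pose task a (w : seq (seq I * nat)) := (forall d, e a = Some d -> G (cyl d) ->
    exists2 c, c \in w & cyl c `<=` cyl d) /\ (forall c, c \in w -> G (cyl c)).
have [||w wtask wfin] := @exists_selection I N lt G task wf tri.
- by move=> E E' EE' GE t /GE /EE'.
- move=> a s; case ea: (e a) => [d|]; last first.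
    by exists [::] => //; split=> // d; rewrite ea.
  have [Gd|nGd] := pselect (G (cyl d)); last first.
    by exists [::] => //; split=> // d'; rewrite ea => -[<-].
  apply: contrapT => nw; pose J := [set i | exists2 b, lt b a & i \in s b].
  (* If no choice works at stage [a], every candidate [cyl c] around the preimage of [K] contains a
     large set over [J]; so the cylinders over [J] already yield a neighbourhood base of [K]. *)
  have PJ : P (words J).
    move=> U oU KU.
    have [||c [Kc cU]] := @interpolate K (U `&` inner (cyl d)) cK.
    + by apply: openI => //; exact: inner_open (@dep_cyl _ d).
    + by move=> x Kx; split; [exact: KU|exact: (sub_inner _ _).1 Gd _ Kx].
    apply: contrapT => nE; apply: nw; exists [:: c].
      split=> [d' |c']; last by rewrite inE => /eqP ->.
      rewrite ea => -[<-] _; exists c; rewrite ?mem_head // => t /cU[_].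
      exact.
    move=> c'; rewrite inE => /eqP -> l E lJ lE GE Ec; apply: nE.
    have [n lnE] := depP lE; exists (l, n); rewrite lnE; split=> // t /Ec /cU[].
    by [].
  have [|[l0 Jl0]|/(_ _ (gen_words J))//] := small a s; first by rewrite ea.
  (* For finite [J] only finitely many sets [inner E] arise; a large one inside [K] would equal [K],
     which is not open. *)
  have [||U [oU KU UD]] :=
    @escape_finite [set inner E | E in [set E | dep l0 E /\ G E]] K.
  + by apply: sub_finite_set (finite_inner_dep l0) => _ [E [lE _] <-]; exists E.
  + move=> _ [E [lE GE] <-] EK; apply: noK.
    rewrite (_ : K = inner E); first exact: inner_open lE.
    by apply/seteqP; split=> //; exact/sub_inner.
  have [c [Jc Gc cU]] := PJ U oU KU.
  apply: (UD (inner (cyl c))); last exact: inner_sub.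
  by exists (cyl c) => //; split=> //; exact: words_dep Jc.
exists [set b | exists a c, c \in w a /\ b = inner (cyl c)]; split.
  split=> [_ [a [c [ca ->]]]|U oU KU].
    split; first exact: inner_open (@dep_cyl _ c).
    by apply/sub_inner; exact: (wtask a).2 c ca.
  have [d [[a ea] Gd dU]] := Pe U oU KU.
  have [c ca cd] := (wtask a).1 d ea Gd; exists (inner (cyl c)); split.
    by exists a, c.
  by apply: inner_sub => t /cd /dU.
apply: selection_op_like wfin _ => a c ca.
have [||d [Kd dc]] := @interpolate K (inner (cyl c)) cK.
- exact: inner_open (@dep_cyl _ c).
- by apply/sub_inner; exact: (wtask a).2 c ca.
by exists d.1, (cyl d); split=> //; exact: dep_cyl.
Qed.

(** * Pi-bases *)

Definition has_inner E := inner E !=set0.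

Lemma has_innerS E E' : E `<=` E' -> has_inner E -> has_inner E'.
Proof. by move=> EE' [x Ex]; exists x; exact: inner_mono Ex. Qed.

Lemma inner_has_inner c : has_inner (cyl c) ->
  exists l E, [/\ dep l E, has_inner E & E `<=` f @^-1` inner (cyl c)].
Proof.
move=> [x cx]; have [d [dx dc]] := interpolate1 (inner_open (@dep_cyl _ c)) cx.
by exists d.1, (cyl d); split=> //; [exact: dep_cyl|exists x].
Qed.

(** For stages preceded by finitely many coordinates: finitely many sets depend on [l], and no
    nonempty [inner E] fits into a point that is not isolated. *)
Lemma escape_dep l x U : ~ open [set x] -> open U -> U x ->
  exists V, [/\ open V, V x, V `<=` U &
    forall E, dep l E -> has_inner E -> ~ E `<=` f @^-1` V].
Proof.
move=> nox oU Ux.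
have [||V [oV Vx VD]] :=
  @escape_finite [set inner E | E in [set E | dep l E /\ has_inner E]] [set x].
- by apply: sub_finite_set (finite_inner_dep l) => _ [E [lE _] <-]; exists E.
- move=> _ [E [lE [y Ey]] <-] Ex; apply: nox.
  rewrite (_ : [set x] = inner E); first exact: inner_open lE.
  by apply/seteqP; split=> // _ ->; rewrite -(Ex y Ey).
exists (V `&` U); split=> //; first exact: openI.
- by split=> //; exact: Vx.
move=> E lE GE EV; apply: (VD (inner E)); first by exists E.
by apply: inner_sub => t /EV[].
Qed.

(** [P] asks for a pi-base of some [U'] inside [U], so the minimality of the stages also applies to
    smaller open sets and is contradicted by a failure inside [inner (cyl d)]. *)
Lemma dyadic_local_pi_base U : open U -> U !=set0 ->
  (forall x, U x -> ~ open [set x]) ->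
  exists U' B, [/\ open U', U' !=set0, U' `<=` U, omega_op_like B &
    (forall b, B b -> [/\ open b, b !=set0 & b `<=` U']) /\
    (forall V, open V -> V !=set0 -> V `<=` U' -> exists b, B b /\ b `<=` V)].
Proof.
move=> oU U0 nisol.
pose PU (S : set (seq I * nat)) U' := forall V, open V -> V !=set0 -> V `<=` U' ->
  exists c, [/\ S c, has_inner (cyl c) & cyl c `<=` f @^-1` V].
pose P S := exists U', [/\ open U', U' !=set0, U' `<=` U & PU S U'].
have PT : P setT.
  exists U; split=> // V oV [x Vx] _; have [c [cx cV]] := interpolate1 oV Vx.
  by exists c; split=> //; exists x.
have Pmono S S' : S `<=` S' -> P S -> P S'.
  move=> SS' [U' [oU' U'0 U'U PS]]; exists U'; split=> // V oV V0 VU'.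
  by have [c [/SS']] := PS V oV V0 VU'; exists c.
have [N [lt [e [wf tri [U' [oU' U'0 U'U Pe]] small]]]] := exists_stages I PT Pmono.
pose good d := has_inner (cyl d) /\ cyl d `<=` f @^-1` U'.
pose task a (w : seq (seq I * nat)) := (forall d, e a = Some d -> good d ->
    exists2 c, c \in w & cyl c `<=` cyl d) /\ (forall c, c \in w -> good c).
have [||w wtask wfin] := @exists_selection I N lt has_inner task wf tri.
- exact: has_innerS.
- move=> a s; case ea: (e a) => [d|]; last first.
    by exists [::] => //; split=> // d; rewrite ea.
  have [[Gd dU']|nGd] := pselect (good d); last first.
    by exists [::] => //; split=> // d'; rewrite ea => -[<-].
  apply: contrapT => nw; pose J := [set i | exists2 b, lt b a & i \in s b].
  have od : open (inner (cyl d)) by exact: inner_open (@dep_cyl _ d).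
  have PJ : PU (words J) (inner (cyl d)).
    move=> V oV [x Vx] Vd; have [c [cx cV]] := interpolate1 oV Vx.
    have cd : cyl c `<=` cyl d by move=> t /cV /Vd; exact.
    apply: contrapT => nE; apply: nw; exists [:: c].
      split=> [d' |c'].
        by rewrite ea => -[<-] _; exists c; rewrite ?mem_head.
      rewrite inE => /eqP ->; split; first by exists x.
      by move=> t /cd /dU'.
    move=> c'; rewrite inE => /eqP -> l E lJ lE GE Ec; apply: nE.
    by have [n lnE] := depP lE; exists (l, n); rewrite lnE; split=> // t /Ec /cV.
  have dU : inner (cyl d) `<=` U by move=> x /(inner_sub dU') /U'U.
  have [|[l0 Jl0]|nP] := small a s; first by rewrite ea.
    have [x dx] := Gd.
    have [V [oV Vx Vd VE]] := escape_dep l0 (nisol x (dU x dx)) od dx.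
    have [|c [Jc Gc cV]] := PJ V oV _ Vd; first by exists x.
    exact: VE (words_dep Jl0 Jc) Gc cV.
  by apply: (nP _ (gen_words J)); exists (inner (cyl d)).
exists U', [set b | exists a c, c \in w a /\ b = inner (cyl c)]; split=> //.
  apply: selection_op_like wfin _ => a c ca; apply: inner_has_inner.
  by have [] := (wtask a).2 c ca.
split=> [_ [a [c [ca ->]]]|V oV V0 VU'].
  have [Gc cU'] := (wtask a).2 c ca; split=> //; last exact: inner_sub.
  exact: inner_open (@dep_cyl _ c).
have [d [[a ea] Gd dV]] := Pe V oV V0 VU'.
have [|c ca cd] := (wtask a).1 d ea; first by split=> // t /dV /VU'.
exists (inner (cyl c)); split; first by exists a, c.
by apply: inner_sub => t /cd /dV.
Qed.

(** A maximal disjoint family of open sets with such pi-bases has dense union, and comparable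
    members of the pi-bases lie in the same piece. An isolated point is a piece by itself. *)
Lemma dyadic_piNt : piNt_omega X.
Proof.
pose R (p : set X * set (set X)) :=
  [/\ open p.1, p.1 !=set0, omega_op_like p.2 &
    (forall b, p.2 b -> [/\ open b, b !=set0 & b `<=` p.1]) /\
    (forall V, open V -> V !=set0 -> V `<=` p.1 -> exists b, p.2 b /\ b `<=` V)].
have Rdense U : open U -> U !=set0 -> exists2 p, R p & p.1 `<=` U.
  move=> oU U0.
  have [[x [Ux ox]]|nisol] := pselect (exists x, U x /\ open [set x]).
    exists ([set x], [set [set x]]); last by move=> _ ->.
    split=> //=; first by exists x.
      by move=> p _; apply: (@sub_finite_set _ _ [set [set x]]) => // q [].
    split=> [b ->|V oV [y Vy] Vx]; first by split=> //; exists x.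
    exists [set x]; split=> // _ ->.
    by rewrite -(Vx y Vy).
  have [|U' [B [oU' U'0 U'U opB BP]]] := dyadic_local_pi_base oU U0.
    by move=> x Ux ox; apply: nisol; exists x.
  by exists (U', B).
have [D [DR Dtriv Dmax]] := ex_maximal_disjoint_subcollection fst R.
exists [set b | exists2 p, D p & p.2 b]; split; first split.
- by move=> b [p /DR[_ _ _ [+ _]] pb] => /(_ b pb)[].
- move=> U oU U0.
  have [p Dp pU] : exists2 p, D p & p.1 `&` U !=set0.
    apply: contrapT => nD; have [q Rq qU] := Rdense U oU U0.
    have nDq p : D p -> ~ (p.1 `&` q.1 !=set0).
      by move=> Dp [x [px /qU Ux]]; apply: nD; exists p => //; exists x.
    apply: (Dmax (D `|` [set q])).
    + split=> [p Dp|/(_ q (or_intror erefl)) Dq]; first by left.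
      by apply: (nDq q Dq); rewrite setIid; case: Rq.
    + by move=> p [/DR//|->].
    + move=> p p' [Dp|->] [Dp'|->] //; first exact: Dtriv.
        by move=> /(nDq p Dp).
      by rewrite setIC => /(nDq p' Dp').
  have [op _ _ [_ pP]] := DR p Dp.
  have [||b [pb bpU]] := pP (p.1 `&` U) _ pU; [exact: openI|by move=> x []|].
  by exists b; split; [exists p|move=> x /bpU[]].
- move=> b [p Dp pb]; have [_ _ opp [pB _]] := DR p Dp.
  apply: sub_finite_set (opp b pb) => c [[p' Dp' p'c] bc]; split=> //.
  rewrite (Dtriv p p' Dp Dp') //.
  have [_ [x bx] bp] := pB b pb; have [_ _ _ [pB' _]] := DR p' Dp'.
  by exists x; split; [exact: bp|have [_ _] := pB' c p'c; apply; exact: bc].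
Qed.

(** * Homogeneous dyadic compacta *)

Definition local_pi_base_on (J : set I) p := forall V, open V -> V p ->
  exists c, [/\ words J c, has_inner (cyl c) & cyl c `<=` f @^-1` V].

(* By compactness some point [x] of the fibre of [p] is a limit of members of the
   local pi-base; moving [x] off [J] does not affect them. *)
Lemma local_pi_base_fiber (J : set I) p : local_pi_base_on J p ->
  exists2 x, f x = p & forall y, (forall i, J i -> y i = x i) -> f y = p.
Proof.
move=> Jp; apply: contrapT => nx.
(* [Q A]: a clopen [W] around [A] misses every cylinder over [J] mapped into some neighbourhood [U]
   of [p]. If the claim failed, [Q] would hold locally on the fibre, hence for all of it. *)
pose Q (A : set cube) := exists l W U, [/\ dep l W, A `<=` W, open U, U p &
  forall c, words J c -> cyl c `<=` f @^-1` U -> ~ (cyl c `&` W !=set0)].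
have [l [W [U [lW pW oU Up UW]]]] : Q (f @^-1` [set p]).
  apply: compact_local.
  - apply: subclosed_compact (@cube_compact _) _ => //.
    apply: closed_comp; first by move=> t _; exact: cf.
    exact: compact_closed hX (@compact_set1 _ p).
  - exists [::], set0, setT; split=> //; first exact: openT.
    by move=> c _ _ [t []].
  - move=> A B [l [W [U [lW AW oU Up UW]]]] [l' [W' [U' [lW' BW' oU' Up' UW']]]].
    exists (l ++ l'), (W `|` W'), (U `&` U'); split=> //.
    + exact: depU.
    + exact: setUSS.
    + exact: openI.
    + move=> c Jc cU [t [ct [Wt|Wt']]].
        by apply: (UW c Jc) => [u /cU[]//|]; exists t.
      by apply: (UW' c Jc) => [u /cU[]//|]; exists t.
  - move=> A B AB [l [W [U [lW BW oU Up UW]]]].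
    by exists l, W, U; split=> // x /AB /BW.
  move=> x fx.
  have [y [yx fy]] : exists y, (forall i, J i -> y i = x i) /\ f y <> p.
    apply: contrapT => ny; apply: nx; exists x => // y yx.
    by apply: contrapT => fy; apply: ny; exists y.
  have := hX; rewrite open_hausdorff => /(_ _ _ (introN eqP fy)).
  move=> [[V U]] /= [/set_mem Vy /set_mem Up] [oV oU /eqP VU].
  have [|l lV] := @nbhs_boxP I y (f @^-1` V).
    by apply: cf; exact: open_nbhs_nbhs.
  pose l' := [seq i <- l | `[< J i >]].
  exists (box x l'); first exact: nbhs_box.
  exists l', (box x l'), U; split=> //; first exact: dep_box.
  move=> c Jc cU [t [ct tx]].
  (* [u] stays in [cyl c], so it is mapped into [U], but is close enough to [y] to be mapped into
     [V]. *)
  pose u : cube := fun i => if `[< J i >] then t i else y i.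
  have Uu : U (f u).
    apply: cU; apply: (@dep_cyl _ c) ct => i /Jc Ji.
    by rewrite /u; case: asboolP.
  have Vu : V (f u).
    apply: lV => i il; rewrite /u; case: asboolP => // Ji.
    by rewrite yx // tx // mem_filter il andbT; apply/asboolP.
  have : (V `&` U) (f u) by [].
  by rewrite VU.
have [||c [Jc [z cz] cU]] := Jp (U `&` inner W).
- by apply: openI => //; exact: inner_open lW.
- by split=> //; exact: (sub_inner _ _).1 pW _ erefl.
have [t tz] := surjf z; apply: (UW c Jc) => [u /cU[]//|].
by exists t; have ct := cz t tz; split=> //; have [_] := cU t ct; apply.
Qed.

(* The closed set [F] below is a union of fibres of the restriction to [J], [f] is
   constant on each of them, and [f] maps [F] onto [X]: so [X] is an image of a
   closed subspace of the cube over [J]. *)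
Lemma local_pi_bases_base (J : set I) :
  (forall c, words J c -> has_inner (cyl c) ->
     exists2 p, inner (cyl c) p & local_pi_base_on J p) ->
  exists B : seq I * nat -> set X, (forall c, open (B c)) /\
    forall U x, open U -> U x -> exists c, [/\ words J c, B c x & B c `<=` U].
Proof.
move=> HJ.
(* On the fibre over [J] of a point of [D], [f] is constant; [F] is the closure of [D] with respect
   to the coordinates in [J]. *)
pose D : set cube := [set x | forall y, (forall i, J i -> y i = x i) -> f y = f x].
pose F : set cube := [set z | forall l, (forall i, i \in l -> J i) ->
  exists2 x, D x & box z l x].
have DF : D `<=` F by move=> x Dx l _; exists x.
(* Overwriting [z] and [z'] on [J] by a nearby [x] in [D] gives two points with image [f x], so any
   neighbourhoods of [f z] and [f z'] meet. *)
have Fconst z z' : F z -> (forall i, J i -> z' i = z i) -> f z' = f z.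
  move=> Fz zz'; apply: hX => V V' Vz' Vz.
  have [l lV] := nbhs_boxP (cf Vz'); have [l' lV'] := nbhs_boxP (cf Vz).
  have [|x Dx xz] := Fz [seq i <- l ++ l' | `[< J i >]].
    by move=> i; rewrite mem_filter => /andP[/asboolP].
  pose u z : cube := fun i => if `[< J i >] then x i else z i.
  have fu y : f (u y) = f x.
    by apply: Dx => i Ji; rewrite /u; case: asboolP.
  exists (f x); split.
    rewrite -(fu z'); apply: lV => i il; rewrite /u; case: asboolP => // Ji.
    rewrite zz' // xz // mem_filter mem_cat il andbT; exact/asboolP.
  rewrite -(fu z); apply: lV' => i il; rewrite /u; case: asboolP => // Ji.
  rewrite xz // mem_filter mem_cat il orbT andbT; exact/asboolP.
have Fsat z z' : F z -> (forall i, J i -> z' i = z i) -> F z'.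
  move=> Fz zz' l lJ; have [x Dx xz] := Fz l lJ; exists x => // i il.
  by rewrite xz // zz' //; exact: lJ.
have cF : closed F.
  rewrite -openC openE => z /existsNP[l /not_implyP[lJ nz]].
  apply: filterS (nbhs_box z l) => y yz Fy; apply: nz.
  by have [x Dx xy] := Fy l lJ; exists x => // i il; rewrite xy // yz.
(* Otherwise some large cylinder is mapped off the image of [F]. Its projection to [J] contains the
   fibre of some [q] with a local pi-base over [J]; a point of [D] in that fibre agrees on [J] with
   a point of the cylinder, and both have image [q]. *)
have Fsurj p : exists2 z, F z & f z = p.
  apply: contrapT => np.
  have oO : open (~` (f @` F)) by rewrite openC; exact: closed_image.
  have [|c [cp cO]] := @interpolate1 p _ oO.
    by move=> [z Fz fz]; apply: np; exists z.
  have [n nE] := depP (dep_cproj (J := J) (@dep_cyl _ c)).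
  have [||q cq Jq] := HJ ([seq i <- c.1 | `[< J i >]], n).
  - by move=> i /=; rewrite mem_filter => /andP[/asboolP].
  - by rewrite nE; exists p; apply: inner_mono cp; exact: sub_cproj.
  have [x fx xconst] := local_pi_base_fiber Jq.
  have Dx : D x by move=> y /xconst ->.
  have := cq x fx; rewrite nE => -[y cy yx].
  apply: (cO y cy); exists x; first exact: DF.
  by rewrite fx; apply/esym/xconst.
exists (fun c => ~` (f @` (F `&` ~` cyl c))); split=> [c|U x oU Ux].
  rewrite openC; apply: closed_image; apply: closedI => //.
  exact: dep_closed (depC (@dep_cyl _ c)).
have oU' : open (f @^-1` U `|` ~` F).
  by apply: openU; [move/continuousP: cf; apply|rewrite openC].
have cA : closed (f @^-1` [set x] `&` F).
  apply: closedI => //; apply: closed_comp; first by move=> t _; exact: cf.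
  exact: compact_closed hX (@compact_set1 _ x).
have [|l [C [lC AC CU]]] := interpolate_cube cA oU'.
  by move=> z [fz Fz]; left; rewrite /= fz.
(* This set is the union of the fibres over [J] lying in [C]. *)
have [n nE] := depP (depC (dep_cproj (J := J) (depC lC))).
exists ([seq i <- l | `[< J i >]], n); rewrite nE; split.
- by move=> i /=; rewrite mem_filter => /andP[/asboolP].
- move=> [z [Fz /contrapT [y nCy yz]] fz]; apply: nCy; apply: AC; split.
    by rewrite /= (Fconst z).
  exact: Fsat yz.
- move=> y By; have [z Fz fz] := Fsurj y.
  have Cz : C z.
    apply: contrapT => nCz; apply: By; exists z => //; split=> // nz; apply: nz.
    exact: sub_cproj.
  by have [|] := CU z Cz; rewrite /= ?fz.
Qed.

(** A homeomorphism taking [p0] to [p] moves [inner (cyl c)] to an open set; [phi c] is the support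
    of a large cylinder mapped into it. *)
Lemma local_pi_base_transfer (J : set I) p0 p : homogeneous X ->
  local_pi_base_on J p0 -> exists phi : seq I * nat -> seq I,
  forall J' : set I, (forall c i, words J c -> i \in phi c -> J' i) ->
    local_pi_base_on J' p.
Proof.
move=> hom Jp0; have [h [g [ch cg hg gh hp]]] := hom p0 p.
have /choice[d dP] : forall c, exists d, has_inner (cyl c) ->
    has_inner (cyl d) /\ cyl d `<=` f @^-1` (g @^-1` inner (cyl c)).
  move=> c; have [[z cz]|nc] := pselect (has_inner (cyl c)); last by exists c.
  have [||d [dz dc]] := @interpolate1 (h z) (g @^-1` inner (cyl c)).
  - by move/continuousP: cg; apply; exact: inner_open (@dep_cyl _ c).
  - by rewrite /= hg.
  by exists d => _; split=> //; exists (h z).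
exists (fst \o d) => J' phiJ' V oV Vp.
have [||c [Jc Gc cV]] := Jp0 (h @^-1` V).
- by move/continuousP: ch; apply.
- by rewrite /= hp.
have [Gd dc] := dP c Gc; exists (d c); split=> // [i|t /dc /= gc].
  exact: phiJ'.
by have := inner_sub cV gc; rewrite /= gh.
Qed.

(** [J] is closed so that every large cylinder over [J'] has in its [inner] a point [pt c] whose
    transferred local pi-base is supported by [J']. *)
Lemma homogeneous_base (J : set I) p0 : homogeneous X ->
  local_pi_base_on J p0 ->
  exists (B : seq I * nat -> set X) (J' : set I), [/\ gen J J', forall c, open (B c) &
    forall U x, open U -> U x -> exists c, [/\ words J' c, B c x & B c `<=` U]].
Proof.
move=> hom Jp0.
have /choice[phi phiP] := fun p => @local_pi_base_transfer J p0 p hom Jp0.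
have /choice[pt ptP] : forall c, exists p, has_inner (cyl c) -> inner (cyl c) p.
  move=> c; have [[p cp]|nc] := pselect (has_inner (cyl c)); first by exists p.
  by exists p0.
have [J' gJ' J'phi] := gen_closure J (fun c d => phi (pt c) d).
have [|B [oB BP]] := @local_pi_bases_base J'; last by exists B, J'.
move=> c J'c Gc; exists (pt c); first exact: ptP.
by apply: phiP => d i Jd; exact: J'phi.
Qed.

Lemma dyadic_homogeneous_Nt : homogeneous X -> Nt_omega X.
Proof.
move=> hom.
have [[x0 ox0]|nisol] := pselect (exists x : X, open [set x]).
  (* By homogeneity one isolated point makes the space discrete. *)
  exists [set [set x] | x in setT]; split; first split.
  - move=> _ [x _ <-]; have [h [g [ch cg hg gh hx]]] := hom x0 x.
    have -> : [set x] = g @^-1` [set x0].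
      apply/seteqP; split=> y /=; first by move=> ->; rewrite -hx hg.
      by move=> gy; rewrite -hx -gy gh.
    by move/continuousP: cg; apply.
  - by move=> U x _ Ux; exists [set x]; split; [exists x| |move=> _ ->].
  - move=> _ [x _ <-]; apply: (@sub_finite_set _ _ [set [set x]]) => //.
    by move=> _ [[y _ <-] /(_ x erefl) <-].
(* Requirements are pairs so that compactness of the closure of the first set gives a finite cover
   inside the second. *)
pose P (S : set (set X * set X)) := forall U x, open U -> U x ->
  exists O : set X * set X,
  [/\ S O, open O.1 /\ open O.2, O.1 x, closure O.1 `<=` O.2 & O.2 `<=` U].
have regX U x : open U -> U x -> exists O, [/\ open O, O x & closure O `<=` U].
  move=> oU Ux; have [c [cx cU]] := interpolate1 oU Ux.
  exists (inner (cyl c)); split=> //; first exact: inner_open (@dep_cyl _ c).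
  have cfc : closed (f @` cyl c) by exact: closed_image (dep_closed (@dep_cyl _ c)).
  move=> y yc; have [t ct <-] : (f @` cyl c) y; last exact: cU.
  apply: cfc; apply: closure_subset yc => z cz; have [t tz] := surjf z.
  by exists t => //; exact: cz.
have PT : P setT.
  move=> U x oU Ux; have [O [oO Ox OU]] := regX U x oU Ux.
  by exists (O, U); split.
have Pmono S S' : S `<=` S' -> P S -> P S'.
  by move=> SS' PS U x oU Ux; have [O [/SS']] := PS U x oU Ux; exists O.
have [N [lt [e [wf tri Pe small]]]] := exists_stages I PT Pmono.
pose good (O : set X * set X) :=
  [/\ open O.1, open O.2 & closure O.1 `<=` O.2].
pose covers (w : seq (seq I * nat)) (A V : set X) := forall x, A x ->
  exists c, [/\ c \in w, inner (cyl c) x & cyl c `<=` f @^-1` V].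
pose task a w := (forall O : set X * set X, e a = Some O -> good O ->
    covers w (closure O.1) O.2)
  /\ (forall c, c \in w -> has_inner (cyl c)).
have [||w wtask wfin] := @exists_selection I N lt has_inner task wf tri.
- exact: has_innerS.
- move=> a s; case ea: (e a) => [O|]; last first.
    by exists [::] => //; split=> // O; rewrite ea.
  have [[oO1 oO2 clO]|nO] := pselect (good O); last first.
    by exists [::] => //; split=> // O'; rewrite ea => -[<-].
  pose J := [set i | exists2 b, lt b a & i \in s b].
  pose free c := forall l E, (forall i, i \in l -> J i) -> dep l E ->
    has_inner E -> ~ E `<=` cyl c.
  have freeP x U : open U -> U x ->
      exists c, [/\ inner (cyl c) x, cyl c `<=` f @^-1` U & free c].
    move=> oU Ux; have [|[l0 Jl0]|nP] := small a s; first by rewrite ea.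
      have nox : ~ open [set x] by move=> ox; apply: nisol; exists x.
      have [V [oV Vx VU VE]] := escape_dep l0 nox oU Ux.
      have [c [cx cV]] := interpolate1 oV Vx; exists c; split=> //.
        by move=> t /cV /VU.
      move=> l E lJ lE GE Ec; apply: (VE E) => //.
        by apply: dep_sub lE => i /lJ /Jl0.
      by move=> t /Ec /cV.
    (* Without a free cylinder [J] supports a local pi-base at [x]. Homogeneity yields a base, whose
       pairs are enumerated over [J] and satisfy [P], against the minimality of the stages. *)
    apply: contrapT => nfree.
    have Jx : local_pi_base_on J x.
      move=> V oV Vx.
      have [c [cx cVU]] := interpolate1 (openI oV oU) (conj Vx Ux).
      apply: contrapT => nE; apply: nfree; exists c; split=> //.
        by move=> t /cVU[].
      move=> l E lJ lE GE Ec; apply: nE; have [n nE] := depP lE.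
      by exists (l, n); rewrite nE; split=> // t /Ec /cVU[].
    have [B [J' [gJ' oB BP]]] := homogeneous_base hom Jx.
    have gS := gen_map (fun c => Some (B c.1, B c.2))
      (gen_pair (gen_words J') (gen_words J')).
    apply: (nP _ (gen_trans gJ' gS)) => V y oV Vy.
    have [c' [J'c' c'y c'V]] := BP V y oV Vy.
    have [W [oW Wy Wc']] := regX _ y (oB c') c'y.
    have [c [J'c cy cW]] := BP W y oW Wy.
    exists (B c, B c'); split=> //=; first by exists (c, c').
    by move=> z /(closure_subset cW) /Wc'.
  have [w [wP wO]] : exists w, (forall c, c \in w -> has_inner (cyl c) /\ free c) /\
      covers w (closure O.1) O.2.
    apply: (@compact_local _ _ (fun A => exists w,
      (forall c, c \in w -> has_inner (cyl c) /\ free c) /\ covers w A O.2)).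
    + exact: subclosed_compact (@closed_closure _ _) compactX _.
    + by exists [::]; split.
    + move=> A A' [w [wP wA]] [w' [wP' wA']]; exists (w ++ w'); split.
        by move=> c; rewrite mem_cat => /orP[/wP|/wP'].
      by move=> x [/wA|/wA'] [c [cw cx cO]]; exists c;
        split=> //; rewrite mem_cat cw ?orbT.
    + by move=> A A' AA' [w [wP wA']]; exists w; split=> // x /AA' /wA'.
    + move=> x /clO Ox; have [c [cx cO cfree]] := freeP x _ oO2 Ox.
      exists (inner (cyl c)).
        by apply: open_nbhs_nbhs; split=> //; exact: inner_open (@dep_cyl _ c).
      exists [:: c]; split=> [c'|y cy].
        by rewrite inE => /eqP ->; split=> //; exists x.
      by exists c; split; rewrite ?mem_head.
  exists w; last by move=> c /wP[].
  by split=> [O'|c /wP[]//]; rewrite ea => -[<-].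
exists [set b | exists a c, c \in w a /\ b = inner (cyl c)]; split.
  split=> [_ [a [c [ca ->]]]|U x oU Ux].
    exact: inner_open (@dep_cyl _ c).
  have [O [[a ea] [oO1 oO2] Ox clO OU]] := Pe U x oU Ux.
  have [|c [ca cx cO]] := (wtask a).1 O ea _ x (subset_closure Ox); first by split.
  exists (inner (cyl c)); split=> //; first by exists a, c.
  by apply: inner_sub => t /cO /OU.
apply: selection_op_like wfin _ => a c ca; apply: inner_has_inner.
exact: (wtask a).2 c ca.
Qed.

End DyadicImage.

Theorem theorem1p5 (X : topologicalType) :
  dyadic_compactum X ->
  (piNt_omega X /\ chiKNt_omega X) /\ (homogeneous X -> Nt_omega X).
Proof.
move=> [hX [I [f [cf sf]]]]; split; last first.
  exact: (@dyadic_homogeneous_Nt {classic I} X f hX cf sf).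
split; first exact: (@dyadic_piNt {classic I} X f hX cf sf).
by move=> K; exact: (@dyadic_chiNt {classic I} X f hX cf sf K).
Qed.
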